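(* Let $G=(V,E,w)$ be a weighted undirected graph, let $k\ge 1$ and $r\ge 2$ be integers, and let $V=V_0\supseteq V_1\supseteq\cdots\supseteq V_k\supseteq V_{k+1}=\emptyset$. Let $H=E_0\cup\cdots\cup E_k$ be the edge set defined below, and let $h_0=1$ and $h_i=(r+1)h_{i-1}+r$ for $i\in[1,k]$. Then for any real $\mu$, for all $i\in[0,k]$ and all $u,v\in V$ with $\dist_G(u,v)\le r^i\mu$, at least one of the following holds: (i) $\dist^{(h_i)}_{G\cup H}(u,v)\le \dist_G(u,v) + ((r+4)^i - r^i)\mu$; (ii) there exists $u_{i+1}\in V_{i+1}$ with $\dist^{(h_i)}_{G\cup H}(u,u_{i+1})\le (r+4)^i\mu$.
   Context: $\dist_G(u,v)$ is the shortest-path distance in $G$ (nonnegative edge lengths), and $\dist^{(\beta)}_{G\cup H}(u,v)$ is the length of a shortest $u$--$v$ path using at most $\beta$ edges in the graph $G\cup H$ obtained by adding the weighted edges of $H$ to $G$. For $v\in V$ and $i\in[1,k]$, $p_i(v)$ is any vertex of $V_i$ with $\dist_G(v,p_i(v))=\dist_G(v,V_i)$; by convention $p_{k+1}(v)$ does not exist and $\dist_G(v,p_{k+1}(v))=\infty$. For $v\in V_i\setminus V_{i+1}$, define $\mathcal{B}(v)=\{u\in V_i : \dist_G(v,u)<\dist_G(v,p_{i+1}(v))\}$. For $i\in[0,k]$, $E_i=\bigcup_{v\in V_i\setminus V_{i+1}}\{(v,u) : u\in\mathcal{B}(v)\cup\{p_{i+1}(v)\}\}$ (with $p_{i+1}(v)$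 included only if it exists), and every edge $(x,y)\in H$ has length $\dist_G(x,y)$. *)

(* Defs.v *)
From HB Require Import structures.
From mathcomp Require Import all_boot all_order all_algebra.
From mathcomp Require Import classical_sets reals constructive_ereal ereal.

Set Implicit Arguments.
Unset Strict Implicit.
Unset Printing Implicit Defensive.

Import Order.TTheory GRing.Theory Num.Theory.

Local Open Scope ring_scope.

(* Lengths of non-adjacent pairs are irrelevant. Loops are not excluded. *)
Record wgraph (R : realType) (V : finType) := WGraph {
  edge : rel V;
  len : V -> V -> R;
  edge_sym : symmetric edge;
  len_sym : forall x y, edge x y -> len x y = len y x;
  len_ge0 : forall x y, edge x y -> 0 <= len x y
}.

(* The walk is x, s_0, s_1, ..., so it has size s edges. *)
Fixpoint walk_len (R : realType) (V : finType) (l : V -> V -> \bar R)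
    (x : V) (s : seq V) : \bar R :=
  if s is y :: s' then (l x y + walk_len l y s')%E else 0%E.

(* Infima over walks: these are attained, as V is finite and lengths are
   nonnegative, and equal +oo when there is no walk. *)
Definition dist (R : realType) (V : finType) (G : wgraph R V) (u v : V)
    : \bar R :=
  ereal_inf [set walk_len (fun x y => (len G x y)%:E) u s | s in
             [set s | path (edge G) u s /\ last u s = v]]%classic.

Definition dist_set (R : realType) (V : finType) (G : wgraph R V) (v : V)
    (A : {set V}) : \bar R :=
  \big[Order.min/+oo%E]_(u in A) dist G v u.

(* H is a set of unordered edges: (x, y) and (y, x) stand for the same edge. *)
Definition in_edges (V : finType) (H : {set V * V}) : rel V :=
  fun x y => ((x, y) \in H) || ((y, x) \in H).

Definition union_edge (R : realType) (V : finType) (G : wgraph R V)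
    (H : {set V * V}) : rel V :=
  fun x y => edge G x y || in_edges H x y.

(* An edge (x, y) of H has length dist G x y; if {x, y} is an edge both of G
   and of H, the two edges are parallel and a shortest path uses the shorter. *)
Definition union_len (R : realType) (V : finType) (G : wgraph R V)
    (H : {set V * V}) (x y : V) : \bar R :=
  Order.min (if edge G x y then (len G x y)%:E else +oo%E)
            (if in_edges H x y then dist G x y else +oo%E).

Definition hop_dist (R : realType) (V : finType) (G : wgraph R V)
    (H : {set V * V}) (b : nat) (u v : V) : \bar R :=
  ereal_inf [set walk_len (union_len G H) u s | s in
             [set s | [/\ path (union_edge G H) u s, last u s = v
                        & (size s <= b)%N]]]%classic.

Definition hierarchy (V : finType) (k : nat) (Vs : nat -> {set V}) : Prop :=
  [/\ Vs 0%N = [set: V]%SET,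
      (forall i, (i <= k)%N -> Vs i.+1 \subset Vs i)
    & Vs k.+1 = finset.set0].

(* p i v is the chosen nearest vertex p_i(v) of V_i; None means that it does
   not exist, i.e. that V_i is empty, which is always the case for i = k+1. *)
Definition pivots (R : realType) (V : finType) (G : wgraph R V) (k : nat)
    (Vs : nat -> {set V}) (p : nat -> V -> option V) : Prop :=
  forall i v, (1 <= i <= k.+1)%N ->
    if p i v is Some q then q \in Vs i /\ dist G v q = dist_set G v (Vs i)
    else Vs i = finset.set0.

Definition pivot_dist (R : realType) (V : finType) (G : wgraph R V)
    (p : nat -> V -> option V) (i : nat) (v : V) : \bar R :=
  if p i v is Some q then dist G v q else +oo%E.

(* B(v), for v in V_i \ V_(i+1). *)
Definition bunch (R : realType) (V : finType) (G : wgraph R V)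
    (Vs : nat -> {set V}) (p : nat -> V -> option V) (i : nat) (v : V)
    : {set V} :=
  [set u in Vs i | (dist G v u < pivot_dist G p i.+1 v)%E]%SET.

Definition level_edges (R : realType) (V : finType) (G : wgraph R V)
    (Vs : nat -> {set V}) (p : nat -> V -> option V) (i : nat)
    : {set V * V} :=
  [set e : V * V | (e.1 \in Vs i :\: Vs i.+1) &&
     ((e.2 \in bunch G Vs p i e.1) || (p i.+1 e.1 == Some e.2))]%SET.

Definition hopset (R : realType) (V : finType) (G : wgraph R V) (k : nat)
    (Vs : nat -> {set V}) (p : nat -> V -> option V) : {set V * V} :=
  (\bigcup_(i < k.+1) level_edges G Vs p i)%SET.

Fixpoint hops (r i : nat) : nat :=
  if i is j.+1 then ((r + 1) * hops r j + r)%N else 1%N.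

(* Main.v *)
(* Induction on i. Put D = r^(i-1) mu, T = (r+4)^(i-1) mu and A = T - D. Cut a
   shortest u-v path greedily into at most r segments of length at most D joined
   by single edges, and apply the induction hypothesis to each segment from both
   of its ends. If no segment falls into case (ii), concatenation gives (i).
   Otherwise the left end of the first segment that does is within T of some z1
   in V_i, and the right end of the last one within T of some z2 in V_i. Either
   z1-z2 is a hopset edge, and the detour through it gives (i) since
   (r-1)A + 4T <= (r+4)T - rD, or z1 is in V_(i+1) or joined to
   p_(i+1)(z1), at distance at most d(z1,z2), which gives (ii). *)

Require Import Defs.
From HB Require Import structures.
From mathcomp Require Import all_boot all_order all_algebra.
From mathcomp Require Import boolp classical_sets reals constructive_ereal ereal.
From mathcomp Require Import zify lra.

Set Implicit Arguments.
Unset Strict Implicit.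
Unset Printing Implicit Defensive.

Import Order.TTheory GRing.Theory Num.Theory.

Local Open Scope ring_scope.

(** * Attained infima *)

(** Sequences of size at most [b] over a finite type form a finite type, so [f] has a minimum over
    those in [A]; by hypothesis it bounds [f] on all of [A]. *)
Lemma ereal_inf_bseq_attained (R : realType) (V : finType)
    (f : seq V -> \bar R) (A : set (seq V)) (b : nat) :
  (forall s, A s -> exists2 t, A t & (size t <= b)%N /\ (f t <= f s)%E) ->
  A !=set0%classic ->
  exists2 s, A s & f s = ereal_inf (f @` A)%classic.
Proof.
move=> short [s0 /short[t0 At0 [t0b _]]].
pose P := [pred t : {bseq b of V} | `[< A t >]].
have P0 : P (Bseq t0b) by apply/asboolP.
case: (arg_minP (fun t : {bseq b of V} => f t) P0) => t /asboolP At tmin.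
exists t => //; apply/eqP; rewrite eq_le; apply/andP; split; last first.
  by apply: ereal_inf_lbound; exists t.
apply: le_ereal_inf_tmp => _ [s /short[t' At' [t'b t's]] <-].
by apply: le_trans t's; apply: (tmin (Bseq t'b)); apply/asboolP.
Qed.

(** * Walks: concatenation, reversal, loop erasure *)

Section Walks.
Variables (R : realType) (V : finType).
Implicit Types (e : rel V) (l : V -> V -> \bar R).

Lemma walk_len_cat l u s1 s2 :
  (walk_len l u (s1 ++ s2) = walk_len l u s1 + walk_len l (last u s1) s2)%E.
Proof. by elim: s1 u => [|y s IH] u /=; rewrite ?add0e// IH addeA. Qed.

Lemma walk_len_ge0 e l : (forall x y, e x y -> 0 <= l x y)%E ->
  forall s u, path e u s -> (0 <= walk_len l u s)%E.
Proof.
move=> l0; elim=> [|y s IH] u //= /andP[uy ys].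
by rewrite adde_ge0 ?l0 ?IH.
Qed.

Lemma walk_rev e l : symmetric e -> (forall x y, e x y -> l x y = l y x) ->
  forall s u, path e u s -> exists t,
    [/\ path e (last u s) t, last (last u s) t = u, size t = size s
      & walk_len l (last u s) t = walk_len l u s].
Proof.
move=> esym lsym; elim=> [|y s IH] u /=; first by exists [::].
case/andP=> uy /IH[t [pt lt st wt]]; exists (rcons t u); split.
- by rewrite rcons_path pt lt esym.
- by rewrite last_rcons.
- by rewrite size_rcons st.
- by rewrite -cats1 walk_len_cat /= lt wt adde0 addeC (lsym _ _ uy).
Qed.

(** Loop erasure: when [u] reappears in the tail, only the part after that occurrence is kept;
    dropping the closed part costs nothing as lengths are nonnegative. *)
Lemma walk_uniq e l : (forall x y, e x y -> 0 <= l x y)%E ->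
  forall s u, path e u s -> exists t,
    [/\ path e u t, last u t = last u s, uniq (u :: t)
      & (walk_len l u t <= walk_len l u s)%E].
Proof.
move=> l0; elim=> [|y s IH] u /=; first by exists [::].
case/andP=> uy /IH[t [pt lt ut wt]].
case: (boolP (u \in y :: t)) => [uyt|nuyt]; last first.
  by exists (y :: t); rewrite /= uy pt lt leeD2l// nuyt.
have p' : path e u (y :: t) by rewrite /= uy.
have w' : (walk_len l u (y :: t) <= l u y + walk_len l y s)%E by rewrite leeD2l.
have {}lt : last u (y :: t) = last y s by [].
case/splitPr: uyt lt ut p' w' => p1 p2.
rewrite last_cat cat_path cat_uniq walk_len_cat /=.
move=> lt /and3P[_ _ up2] /and3P[pp1 lu pp2] w'; exists p2; split=> //.
apply: le_trans w'; rewrite lee_paddl ?(walk_len_ge0 l0)//.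
by rewrite lee_paddl// l0.
Qed.

End Walks.

(** * The distance of [G] as an extended metric *)

Section Hopset.
Variables (R : realType) (V : finType) (G : wgraph R V).
Implicit Types (H : {set V * V}) (u v w : V).
Local Notation glen := (fun x y => (len G x y)%:E).

Let glen_ge0 x y : edge G x y -> (0 <= glen x y)%E.
Proof. by move=> /(len_ge0 (w := G)). Qed.

Lemma dist_le_walk u s : path (edge G) u s ->
  (dist G u (last u s) <= walk_len glen u s)%E.
Proof. by move=> us; apply: ereal_inf_lbound; exists s. Qed.

(** Loop erasure bounds the size of the walks to consider; a finite distance excludes the empty set
    of walks, whose infimum is [+oo]. *)
Lemma dist_attained u v : (dist G u v < +oo)%E ->
  exists s, [/\ path (edge G) u s, last u s = v & walk_len glen u s = dist G u v].
Proof.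
rewrite /dist; set A := [set s | _]%classic => fin.
have [s||s [us sv] ws] := @ereal_inf_bseq_attained R V (walk_len glen u) A #|V|.
- case=> us sv; have [t [ut tv /card_uniqP ct wt]] := walk_uniq glen_ge0 us.
  exists t; first by split=> //; rewrite tv.
  by split=> //; apply: ltnW; rewrite -[(size t).+1]/(size (u :: t)) -ct max_card.
- apply/set0P/eqP => A0; move: fin; rewrite A0 image_set0 ereal_inf0.
  by rewrite ltxx.
- by exists s.
Qed.

Lemma dist_ge0 u v : (0 <= dist G u v)%E.
Proof.
by apply: le_ereal_inf_tmp => _ [s [us _] <-]; apply: walk_len_ge0 glen_ge0 _ _ us.
Qed.

Lemma dist_sym u v : dist G u v = dist G v u.
Proof.
wlog suff: u v / (dist G u v <= dist G v u)%E.
  by move=> le_d; apply/eqP; rewrite eq_le !le_d.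
case: (ltP (dist G v u) +oo%E) => [|/(le_trans (leey _))//].
case/dist_attained=> s [vs <- <-].
have lsym x y : edge G x y -> glen x y = glen y x by move=> /(len_sym (w := G)) ->.
have [t [pt lt _ wt]] := walk_rev (edge_sym G) lsym vs.
by have := dist_le_walk pt; rewrite lt wt.
Qed.

Lemma dist_triangle v u w : (dist G u w <= dist G u v + dist G v w)%E.
Proof.
case: (ltP (dist G u v) +oo%E) => [|]; last first.
  rewrite leye_eq => /eqP ->; rewrite addye ?leey//.
  by rewrite -ltNye (lt_le_trans _ (dist_ge0 _ _)) ?ltNyr.
case: (ltP (dist G v w) +oo%E) => [|]; last first.
  rewrite leye_eq => /eqP -> _; rewrite addey ?leey//.
  by rewrite -ltNye (lt_le_trans _ (dist_ge0 _ _)) ?ltNyr.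
case/dist_attained=> t [vt tw <-] /dist_attained[s [us sv <-]].
subst v; rewrite -walk_len_cat -tw -last_cat.
by apply: dist_le_walk; rewrite cat_path us.
Qed.

(** * Hop-bounded distances in the union *)

Lemma union_len_sym H x y : union_len G H x y = union_len G H y x.
Proof.
rewrite /union_len edge_sym dist_sym /in_edges orbC.
by case: ifP => // /(len_sym (w := G)) ->.
Qed.

Lemma dist_le_union_len H x y : (dist G x y <= union_len G H x y)%E.
Proof.
rewrite le_min; apply/andP; split; case: ifP; rewrite ?leey// => xy.
rewrite -[leRHS]adde0; apply: (@dist_le_walk x [:: y]) => /=.
by rewrite xy.
Qed.

(** Edges of [H] save hops but never length: each edge of the union is at least as long as the
    distance between its ends, and the triangle inequality adds these up. *)
Lemma dist_le_hop_dist H b u v : (dist G u v <= hop_dist G H b u v)%E.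
Proof.
apply: le_ereal_inf_tmp => _ [s [us <- _] <-] {v b}.
elim: s u us => [|y s IH] u /=.
  by move=> _; apply: (@dist_le_walk u [::]).
case/andP=> _ /IH ys; apply: le_trans (dist_triangle y _ _) _.
by rewrite leeD// dist_le_union_len.
Qed.

Lemma hop_distP H b u v (c : R) :
  (hop_dist G H b u v <= c%:E)%E <->
  exists s, [/\ path (union_edge G H) u s, last u s = v, (size s <= b)%N
    & (walk_len (union_len G H) u s <= c%:E)%E].
Proof.
split=> [hc|[s [us sv sb]]]; last first.
  by apply: le_trans; apply: ereal_inf_lbound; exists s.
move: hc; rewrite /hop_dist; set A := [set s | _]%classic => hc.
have [s||s [us sv sb] ws] :=
  @ereal_inf_bseq_attained R V (walk_len (union_len G H) u) A b.
- by move=> As; exists s => //; case: As.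
- apply/set0P/eqP => A0; move: hc; rewrite A0 image_set0 ereal_inf0.
  by rewrite leye_eq.
- by exists s; split=> //; rewrite ws.
Qed.

Lemma hop_dist_mono H b b' u v (c c' : R) : (b <= b')%N -> c <= c' ->
  (hop_dist G H b u v <= c%:E)%E -> (hop_dist G H b' u v <= c'%:E)%E.
Proof.
move=> bb cc /hop_distP[s [us sv sb ws]]; apply/hop_distP; exists s; split=> //.
  exact: leq_trans bb.
by apply: le_trans ws _; rewrite lee_fin.
Qed.

Lemma hop_dist_refl H b u (c : R) : 0 <= c -> (hop_dist G H b u u <= c%:E)%E.
Proof. by move=> c0; apply/hop_distP; exists [::]; rewrite lee_fin. Qed.

Lemma hop_dist_trans H b1 b2 u v w (c1 c2 : R) :
  (hop_dist G H b1 u v <= c1%:E)%E -> (hop_dist G H b2 v w <= c2%:E)%E ->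
  (hop_dist G H (b1 + b2) u w <= (c1 + c2)%:E)%E.
Proof.
move=> /hop_distP[s [us sv sb ws]] /hop_distP[t [vt tw tb wt]]; subst v.
apply/hop_distP; exists (s ++ t); split.
- by rewrite cat_path us.
- by rewrite last_cat.
- by rewrite size_cat leq_add.
- by rewrite walk_len_cat EFinD leeD.
Qed.

Lemma hop_dist_sym H b u v (c : R) :
  (hop_dist G H b u v <= c%:E)%E -> (hop_dist G H b v u <= c%:E)%E.
Proof.
move=> /hop_distP[s [us <- sb ws]]; apply/hop_distP.
have esym : symmetric (union_edge G H).
  by move=> x y; rewrite /union_edge edge_sym /in_edges [((x, y) \in H) || _]orbC.
have [t [pt lt st wt]] := walk_rev esym (fun x y _ => union_len_sym H x y) us.
by exists t; rewrite st wt.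
Qed.

Lemma hop_dist_edge H x y : edge G x y ->
  (hop_dist G H 1 x y <= (len G x y)%:E)%E.
Proof.
move=> xy; apply/hop_distP; exists [:: y]; split=> //=.
  by rewrite /union_edge xy.
by rewrite adde0 /union_len xy ge_min lexx.
Qed.

Lemma hop_dist_hop H x y (c : R) : (x, y) \in H -> (dist G x y <= c%:E)%E ->
  (hop_dist G H 1 x y <= c%:E)%E.
Proof.
move=> xy dc; apply/hop_distP; exists [:: y]; split=> //=.
  by rewrite /union_edge /in_edges xy orbT.
by rewrite adde0 /union_len /in_edges xy ge_min dc orbT.
Qed.

Lemma dist_le_trans u v w (c1 c2 : R) :
  (dist G u v <= c1%:E)%E -> (dist G v w <= c2%:E)%E ->
  (dist G u w <= (c1 + c2)%:E)%E.
Proof.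
by move=> h1 h2; apply: le_trans (dist_triangle v _ _) _; rewrite EFinD leeD.
Qed.

(** * One hop inside a level *)

(** If [y] is outside the bunch of [x], the pivot of [x] is no farther than [y] and is joined to
    [x]; if [x] is itself in the next level, it serves as [z]. *)
Lemma hopset_hop (k : nat) (Vs : nat -> {set V}) (p : nat -> V -> option V)
    (i : nat) (x y : V) (c : R) :
  pivots G k Vs p -> (i <= k)%N -> x \in Vs i -> y \in Vs i ->
  (dist G x y <= c%:E)%E ->
  (hop_dist G (hopset G k Vs p) 1 x y <= c%:E)%E \/
  exists2 z, z \in Vs i.+1 & (hop_dist G (hopset G k Vs p) 1 x z <= c%:E)%E.
Proof.
move=> hp ik xi yi dc; have ik' : (i < k.+1)%N by [].
have inH z : (x, z) \in level_edges G Vs p i -> (x, z) \in hopset G k Vs p.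
  by move=> xz; apply/bigcupP; exists (Ordinal ik').
case: (boolP (x \in Vs i.+1)) => [xi1|nxi1].
  right; exists x => //; apply: hop_dist_refl.
  by rewrite -lee_fin (le_trans (dist_ge0 x y)).
case: (boolP (y \in bunch G Vs p i x)) => [yB|].
  by left; apply: hop_dist_hop => //; apply: inH; rewrite finset.in_set /= finset.in_setD nxi1 xi yB.
rewrite !inE yi -leNgt /= /pivot_dist.
have /= := hp i.+1 x; rewrite ik' => /(_ isT).
case px : (p i.+1 x) => [q|] /=; last first.
  (* Without a pivot the bunch is cut off at [+oo], so a [y] outside it would be infinitely far,
     against the bound [c]. *)
  by move=> _ /le_trans/(_ dc); rewrite leye_eq.
case=> qi _ xq; right; exists q => //; apply: hop_dist_hop; last exact: le_trans dc.
by apply: inH; rewrite finset.in_set /= finset.in_setD nxi1 xi px eqxx orbT.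
Qed.

(** * Greedy segmentation of a walk *)

(** The edge from [x] to [y] is the first to push the length of the walk past [D]; [L1] is the
    length before it. *)
Lemma walk_split u s (L D : R) : 0 <= D -> D < L ->
  path (edge G) u s -> walk_len glen u s = L%:E ->
  exists x y t L1 L2,
    [/\ (dist G u x <= L1%:E)%E, L1 <= D, edge G x y &
     [/\ path (edge G) y t, last y t = last u s, walk_len glen y t = L2%:E,
         L1 + len G x y + L2 = L & D < L1 + len G x y]].
Proof.
elim: s u L D => [|y s IH] u L D D0 DL /=.
  by move=> _ [L0]; rewrite -L0 in DL; lra.
case/andP=> uy ys; case ws: (walk_len glen y s) => [L2||] //= [LE].
have uu : (dist G u u <= 0%:E)%E by apply: (@dist_le_walk u [::]).
have [uyD|Duy] := leP (len G u y) D; last first.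
  by exists u, y, s, 0, L2; rewrite add0r.
have [||x [z [t [L1 [L3 [yx L1D xz [zt lt wt LE' DL1]]]]]]] :=
  IH y L2 (D - len G u y) _ _ ys ws; [lra|lra|].
exists x, z, t, (len G u y + L1), L3; split=> //; last by split=> //; lra.
  apply: dist_le_trans yx.
  by have /= := @dist_le_walk u [:: y]; rewrite uy adde0; apply.
lra.
Qed.

Lemma dist_le_hop_dist_trans H b u v (c : R) :
  (hop_dist G H b u v <= c%:E)%E -> (dist G u v <= c%:E)%E.
Proof. exact: le_trans (dist_le_hop_dist _ _ _ _). Qed.

(* A segment is good if h hops span it with additive error A, and bad otherwise.
   First disjunct: all of the at most m.+1 segments are good. Second disjunct: z1
   is near the left end of the first bad one, z2 near the right end of the last
   one; L1 and L2 are the lengths of the walk before and after these two ends,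
   and a and b the numbers of good segments there. *)
Definition segmented H (S : {set V}) (h : nat) (A T : R) (m : nat) u v (L : R) :=
  (hop_dist G H (m.+1 * h + m) u v <= (L + m.+1%:R * A)%:E)%E \/
  exists z1 z2 a b (L1 L2 : R),
    [/\ z1 \in S, z2 \in S, (a + b <= m)%N, 0 <= L2 &
     [/\ (hop_dist G H (a * h.+1 + h) u z1 <= (L1 + a%:R * A + T)%:E)%E,
         (hop_dist G H (b * h.+1 + h) z2 v <= (L2 + b%:R * A + T)%:E)%E,
         (dist G u z2 <= (L - L2 + T)%:E)%E
       & (dist G z1 z2 <= (L - L1 - L2 + T *+ 2)%:E)%E]].

(** Induction on [m]: a segment and the edge after it use up more than [D], so the rest fits the
    bound for one segment fewer. The cases are whether the first segment is bad and whether the rest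
    contains a bad one. *)
Lemma walk_segmented H (S : {set V}) (h : nat) (D A T : R) :
  0 <= D -> 0 <= A ->
  (forall x y (c : R), (dist G x y <= c%:E)%E -> c <= D ->
     (hop_dist G H h x y <= (c + A)%:E)%E \/
     exists2 z, z \in S & (hop_dist G H h x z <= T%:E)%E) ->
  forall m u s (L : R), path (edge G) u s -> walk_len glen u s = L%:E ->
  L <= m.+1%:R * D -> segmented H S h A T m u (last u s) L.
Proof.
move=> D0 A0 base.
(* [base] is applied from both ends: success from either one makes the segment good by symmetry,
   otherwise both ends are near [S]. *)
have segment x y c : (dist G x y <= c%:E)%E -> c <= D ->
    (hop_dist G H h x y <= (c + A)%:E)%E \/
    exists z1 z2, [/\ z1 \in S, z2 \in S, (hop_dist G H h x z1 <= T%:E)%E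
      & (hop_dist G H h y z2 <= T%:E)%E].
  move=> xy cD; have [|[z1 z1S xz1]] := base _ _ _ xy cD; first by left.
  rewrite dist_sym in xy; have [/hop_dist_sym|[z2 z2S yz2]] := base _ _ _ xy cD.
    by left.
  by right; exists z1, z2.
have bad_ends x y c z1 z2 : (dist G x y <= c%:E)%E ->
    (hop_dist G H h x z1 <= T%:E)%E -> (hop_dist G H h y z2 <= T%:E)%E ->
    (dist G x z2 <= (c + T)%:E)%E /\ (dist G z1 z2 <= (T + (c + T))%:E)%E.
  move=> xy /dist_le_hop_dist_trans xz1 /dist_le_hop_dist_trans yz2.
  have xz2 := dist_le_trans xy yz2; split=> //.
  by rewrite dist_sym in xz1; apply: dist_le_trans xz2.
(* A lone bad segment is both the first and the last one, so nothing lies before or after it. *)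
have one_segment m u v L : (dist G u v <= L%:E)%E -> L <= D ->
    segmented H S h A T m u v L.
  move=> uv LD; have [uvA|[z1 [z2 [z1S z2S uz1 vz2]]]] := segment _ _ _ uv LD.
    left; apply: hop_dist_mono uvA; first lia.
    have : 0 <= m%:R * A by apply: mulr_ge0.
    by rewrite -natr1; lra.
  right; exists z1, z2, 0%N, 0%N, 0, 0; split=> //.
  have [uz2 z12] := bad_ends _ _ _ _ _ uv uz1 vz2; split.
  - by rewrite mul0n mul0r !add0r.
  - by rewrite mul0n mul0r !add0r hop_dist_sym.
  - by rewrite subr0.
  - by apply: le_trans z12 _; rewrite lee_fin; lra.
elim=> [|m IH] u s L us ws LD.
  by apply: one_segment; [rewrite -ws dist_le_walk|lra].
have [LD'|DL] := leP L D; first by apply: one_segment; rewrite // -ws dist_le_walk.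
have [x [y [t [L1 [L2 [ux L1D xy [yt <- wt LE DL1]]]]]]] := walk_split D0 DL us ws.
have L20 : 0 <= L2 by rewrite -lee_fin -wt; apply: walk_len_ge0 glen_ge0 _ _ yt.
have w0 := len_ge0 xy.
have hxy := hop_dist_edge H xy; have dxy := dist_le_hop_dist_trans hxy.
have L2D : L2 <= m.+1%:R * D by move: LD; rewrite -[m.+2%:R]natr1; lra.
(* A good first segment joins the good ones that open the rest, whence [a.+1]; the edge from [x] to
   [y] is the extra hop in [h.+1]. *)
have [uxA|[z1 [z2 [z1S z2S uz1 xz2]]]] := segment _ _ _ ux L1D.
  have [yv|] := IH y t L2 yt wt L2D.
    left; apply: hop_dist_mono (hop_dist_trans uxA (hop_dist_trans hxy yv)).
      clear; nia.
    by rewrite -[m.+2%:R]natr1; lra.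
  case=> z1 [z2 [a [b [La [Lb [z1S z2S abm Lb0 [yz1 z2v yz2 z12]]]]]]].
  right; exists z1, z2, a.+1, b, (L1 + len G x y + La), Lb; split=> //.
  split=> //.
  - apply: hop_dist_mono (hop_dist_trans uxA (hop_dist_trans hxy yz1)).
      clear; nia.
    by rewrite -[a.+1%:R]natr1; lra.
  - apply: le_trans (dist_le_trans ux (dist_le_trans dxy yz2)) _.
    by rewrite lee_fin; lra.
  - by apply: le_trans z12 _; rewrite lee_fin; lra.
(* The first segment is bad: nothing precedes it, so [a] and [L1] are 0. *)
have uz1' : (hop_dist G H (0 * h.+1 + h) u z1 <= (0 + 0%:R * A + T)%:E)%E.
  by rewrite mul0n mul0r !add0r.
(* If the rest is all good, the first segment is also the last bad one, and [b] counts the whole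
   rest. *)
have [yv|] := IH y t L2 yt wt L2D.
  have [uz2 z12] := bad_ends _ _ _ _ _ ux uz1 xz2.
  right; exists z1, z2, 0%N, m.+1, 0, (len G x y + L2); split=> //.
    lra.
  split=> //.
  - apply: hop_dist_mono (hop_dist_trans (hop_dist_sym xz2) (hop_dist_trans hxy yv)).
      clear; nia.
    lra.
  - by apply: le_trans uz2 _; rewrite lee_fin; lra.
  - by apply: le_trans z12 _; rewrite lee_fin; lra.
(* Otherwise the last bad segment lies in the rest, from which only [z3], [b] and [Lb] are kept. *)
case=> ? [z3 [a [b [? [Lb [_ z3S abm Lb0 [_ z3v yz3 _]]]]]]].
have uz3 := dist_le_trans ux (dist_le_trans dxy yz3).
right; exists z1, z3, 0%N, b, 0, Lb; split=> //.
  exact: leq_trans (leq_addl a b) (leqW abm).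
split=> //.
- by apply: le_trans uz3 _; rewrite lee_fin; lra.
- have := dist_le_hop_dist_trans uz1; rewrite dist_sym => z1u.
  by apply: le_trans (dist_le_trans z1u uz3) _; rewrite lee_fin; lra.
Qed.

End Hopset.

(** * Induction on the level *)

Theorem theorem4 (R : realType) (V : finType) (G : wgraph R V) (k r : nat)
    (Vs : nat -> {set V}) (p : nat -> V -> option V)
    (hk : (1 <= k)%N) (hr : (2 <= r)%N)
    (hVs : hierarchy k Vs) (hp : pivots G k Vs p)
    (mu : R) (i : nat) (hi : (i <= k)%N) (u v : V)
    (huv : (dist G u v <= (r%:R ^+ i * mu)%:E)%E) :
  (hop_dist G (hopset G k Vs p) (hops r i) u v
     <= dist G u v + (((r + 4)%:R ^+ i - r%:R ^+ i) * mu)%:E)%E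
  \/ (exists2 z : V, z \in Vs i.+1
      & (hop_dist G (hopset G k Vs p) (hops r i) u z
           <= ((r + 4)%:R ^+ i * mu)%:E)%E).
Proof.
have r0 : (0 : R) < r%:R by rewrite ltr0n; lia.
(* [huv] bounds a nonnegative distance by a positive multiple of [mu]. *)
have mu0 : 0 <= mu.
  have /(le_trans (dist_ge0 G u v)) := huv.
  by rewrite lee_fin pmulr_rge0// exprn_gt0.
elim: i hi u v huv => [|i IH] hi u v huv.
  case: hVs => V0 _ _; rewrite !expr0 subrr !mul0r !mul1r adde0 in huv *.
  case duv: (dist G u v) huv (dist_ge0 G u v) => [d||] //; rewrite lee_fin => dmu _.
  have inV0 x : x \in Vs 0%N by rewrite V0 inE.
  have uvd : (dist G u v <= d%:E)%E by rewrite duv.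
  have [uv|[z zV uz]] := hopset_hop hp hi (inV0 u) (inV0 v) uvd; first by left.
  by right; exists z => //; apply: hop_dist_mono uz.
have hi' : (i <= k)%N by apply: ltnW.
pose D := r%:R ^+ i * mu; pose T := (r + 4)%:R ^+ i * mu.
have D0 : 0 <= D by rewrite mulr_ge0// exprn_ge0// ltW.
have DT : D <= T.
  by rewrite ler_wpM2r// lerXn2r ?nnegrE ?ler0n// ler_nat leq_addr.
have ET : (r + 4)%:R ^+ i.+1 * mu = (r%:R + 4) * T by rewrite exprS -mulrA -natrD.
have ED : r%:R ^+ i.+1 * mu = r%:R * D by rewrite exprS -mulrA.
rewrite mulrBl ET ED in huv *.
have [|s [us sv ws]] := @dist_attained _ _ G u v.
  by apply: le_lt_trans huv _; rewrite ltey.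
case duv: (dist G u v) huv (dist_ge0 G u v) ws => [L||] //.
rewrite lee_fin => LD _ ws; have [m rm] : exists m, r = m.+1 by exists r.-1; lia.
have base x y (c : R) : (dist G x y <= c%:E)%E -> c <= D ->
    (hop_dist G (hopset G k Vs p) (hops r i) x y <= (c + (T - D))%:E)%E \/
    exists2 z, z \in Vs i.+1
    & (hop_dist G (hopset G k Vs p) (hops r i) x z <= T%:E)%E.
  move=> xy cD; have [||] := IH hi' x y; last by right.
    by apply: le_trans xy _; rewrite lee_fin.
  move=> xyA; left; apply: le_trans xyA _.
  by rewrite mulrBl -/T -/D [leRHS]EFinD leeD2r.
have LDm : L <= m.+1%:R * D by rewrite -rm.
have DT0 : 0 <= T - D by lra.
have := walk_segmented D0 DT0 base us ws LDm; rewrite sv /segmented -rm => -[uvA|].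
  (* All segments are good: the error is r(T - D), with rh + r - 1 hops for h = [hops r i]. *)
  left; apply: hop_dist_mono uvA; first by rewrite /=; lia.
  lra.
case=> z1 [z2 [a [b [L1 [L2 [z1V z2V abm L20 [uz1 z2v uz2 z12]]]]]]].
have abT : (a + b)%:R * (T - D) <= (r%:R - 1) * (T - D).
  by rewrite ler_wpM2r// rm -natr1 addrK ler_nat.
have aT : a%:R * (T - D) <= (r%:R - 1) * (T - D).
  by apply: le_trans abT; rewrite ler_wpM2r// ler_nat leq_addr.
have abh : (a * (hops r i).+1 + b * (hops r i).+1 <= m * (hops r i).+1)%N.
  by rewrite -mulnDl leq_mul2r abm orbT.
have [z12h|[z zV z1z]] := hopset_hop hp hi z1V z2V z12.
  (* The error is (a + b)(T - D) + 4T, at most (r + 4)T - rD since D <= T. The hops are at most (r -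
     1)(h + 1) + 2h + 1, which is exactly (r + 1)h + r. *)
  left; apply: hop_dist_mono (hop_dist_trans uz1 (hop_dist_trans z12h z2v)).
    by move: abh => /=; move: (hops r i) => h; rewrite rm; clear; nia.
  by rewrite natrD in abT; lra.
(* The length is at most L - L2 + a(T - D) + 3T, hence at most (r + 2)T + D by L <= rD and L2 >=
   0. *)
right; exists z => //; apply: hop_dist_mono (hop_dist_trans uz1 z1z).
  by move: abh => /=; move: (hops r i) => h; rewrite rm; clear; nia.
lra.
Qed.
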